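(* Let $(c_i)_{i\ge 1}$ be a sequence of costs with $c_i\in(0,\infty)$, and set $a_i=\frac{c_i}{1+c_i}$. For each $n\ge 2$ consider the one-shot random access game $G(n,\mathbf{c}_n)$ with $\mathbf{c}_n=(c_1,\dots,c_n)$ (defined in the context), and assume that for every $n\ge 2$ this game has a fully-mixed Nash equilibrium (FMNE). Let $p_{i,n}$ denote the transmission probability of transmitter $i$ at this FMNE, and let $S_n=\sum_{i=1}^n X_i^{(n)}$, where $X_1^{(n)},\dots,X_n^{(n)}$ are independent $\{0,1\}$-valued random variables with $\mathbb{P}\{X_i^{(n)}=1\}=p_{i,n}$ (the actions of the transmitters at the FMNE). Then: (i) $S_n$ converges in distribution as $n\to\infty$ if and only if $\lim_{n\to\infty}\sum_{i=1}^n p_{i,n}$ exists and lies in $(0,\infty)$; (ii) moreover, for any $\epsilon>0$ there exist a Poisson random variable $Po(\lambda)$ and finitely many Bernoulli random variables $Bern(p_1),\dots,Bern(p_K)$, all mutually independent, such that $$\limsup_{n\to\infty} d_V\Big(S_n,\ Po(\lambda)+\sum_{k=1}^K Bern(p_k)\Big)\le \epsilon .$$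
   Context: The game $G(n,\mathbf{c})$, for $\mathbf{c}=(c_1,\dots,c_n)\in(0,\infty)^n$, is the strategic game with player set $\{1,\dots,n\}$ (transmitters), action set $\{0,1\}$ for each player ($1$ = transmit, $0$ = back off), and utilities: $u_i(\mathbf{a})=0$ if $a_i=0$; $u_i(\mathbf{a})=1$ if $a_i=1$ and $\sum_j a_j=1$; $u_i(\mathbf{a})=-c_i$ if $a_i=1$ and $\sum_j a_j\ge 2$. Players use independent mixed strategies (transmission probabilities). A fully-mixed Nash equilibrium is a mixed-strategy Nash equilibrium in which every player transmits with probability strictly in $(0,1)$. (Equivalently: the FMNE of $G(n,\mathbf{c}_n)$ exists iff $a_i>\big(\prod_{j=1}^n a_j\big)^{1/(n-1)}$ for all $1\le i\le n$, and then it is unique with $p_{i,n}=1-a_i^{-1}\big(\prod_{j=1}^n a_j\big)^{1/(n-1)}$.) $Po(\lambda)$ denotes a Poisson random variable with mean $\lambda$ and $Bern(p)$ a $\{0,1\}$-valued Bernoulli random variable with mean $p$; a sum of independent random variables inside $d_V$ refers to the convolution of their distributions. For distributions $\mu,\nu$ on $\mathbb{Z}$, the variational distance is $d_V(\mu,\nu)=\sum_{z\in\mathbb{Z}}|\mu(z)-\nu(z)|$, and $d_V(X,Y)$ means the distance between the distributions of $X$ and $Y$. *)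

(* Defs.v *)
From HB Require Import structures.
From mathcomp Require Import all_boot all_order all_algebra.
From mathcomp Require Import all_classical all_reals all_analysis.
Set Implicit Arguments. Unset Strict Implicit. Unset Printing Implicit Defensive.
Import Order.TTheory GRing.Theory Num.Theory numFieldNormedType.Exports.
Local Open Scope classical_set_scope.
Local Open Scope ring_scope.

Section RandomAccessGame.
Variable R : realType.

(* pure action profiles of n players: true = transmit, false = back off *)
Definition profile (n : nat) := {ffun 'I_n -> bool}.

Definition ntx n (a : profile n) : nat := (\sum_(j < n) (a j : nat))%N.

Definition util n (c : 'I_n -> R) (i : 'I_n) (a : profile n) : R :=
  if a i then (if ntx a == 1%N then 1 else - c i) else 0.

Definition prob_profile n (q : 'I_n -> R) (a : profile n) : R :=
  \prod_(j < n) (if a j then q j else 1 - q j).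

Definition exp_util n (c : 'I_n -> R) (q : 'I_n -> R) (i : 'I_n) : R :=
  \sum_(a : profile n) prob_profile q a * util c i a.

Definition upd n (q : 'I_n -> R) (i : 'I_n) (r : R) : 'I_n -> R :=
  fun j => if j == i then r else q j.

Definition is_mixed_NE n (c : 'I_n -> R) (q : 'I_n -> R) : Prop :=
  (forall j, 0 <= q j <= 1) /\
  (forall i r, 0 <= r <= 1 -> exp_util c (upd q i r) i <= exp_util c q i).

Definition is_FMNE n (c : 'I_n -> R) (q : 'I_n -> R) : Prop :=
  is_mixed_NE c q /\ (forall j, 0 < q j < 1).

Definition law_sum n (q : 'I_n -> R) (k : nat) : R :=
  \sum_(a : profile n | ntx a == k) prob_profile q a.

Definition cdf_sum n (q : 'I_n -> R) (x : R) : R :=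
  \sum_(a : profile n | (ntx a)%:R <= x) prob_profile q a.

Definition distribution_function (F : R -> R) : Prop :=
  {homo F : x y / x <= y} /\
  (forall x, F y @[y --> x^'+] --> F x) /\
  (F x @[x --> -oo] --> (0:R)) /\
  (F x @[x --> +oo] --> (1:R)).

Definition cvg_in_distribution (Fn : nat -> R -> R) : Prop :=
  exists F : R -> R, distribution_function F /\
    forall x, {for x, continuous F} -> Fn n x @[n --> \oo] --> F x.

Definition pmf_conv (f g : nat -> R) (k : nat) : R :=
  \sum_(i < k.+1) f i * g (k - i)%N.

(* variational distance sum_z |mu z - nu z| for pmfs supported on nat
   (extended-real valued nonnegative series, always defined) *)
Definition dV (f g : nat -> R) : \bar R :=
  (\sum_(0 <= k <oo) (`|f k - g k|)%:E)%E.

End RandomAccessGame.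

(* Main.v *)
(** Write a_i = c_i / (1 + c_i) and let A_n be the probability that nobody
    transmits among n players. Indifference gives (1 - p_{i,n}) a_i = A_n, hence
    A_n^(n-1) = a_1 ... a_n. Since A_n < a_i for all i <= n, the sequence A_n is
    increasing, with a limit A in (0, 1). Put r_i = ln (a_i / A) >= 0 and
    T_n = ln (A / A_n) -> 0, so that 1 - p_{i,n} = exp (- r_i - T_n) and
    r_1 + ... + r_n = - ln A - (n - 1) T_n. Hence the series of the r_i converges
    and n T_n has a limit, so the sum of the p_{i,n} always converges to a
    positive number: both sides of (i) hold unconditionally.

    For (ii), keep the first K transmitters as Bernoulli variables with parameters
    1 - exp (- r_i) and replace each later one by a Poisson variable of mean
    r_i + T_n, at cost 2 (r_i + T_n)^2; these means add up to
    (K - 1) T_K + O(T_n), and (K - 1) T_K > 0. Finally, (ii) makes the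
    distribution functions of S_n uniformly Cauchy, whence convergence in
    distribution. Distances between laws are l1 distances between the coefficients
    of generating polynomials, where convolution is multiplication. *)
Require Import Defs.
From HB Require Import structures.
From mathcomp Require Import all_boot all_order all_algebra.
From mathcomp Require Import all_classical all_reals all_analysis.
From mathcomp Require Import ring lra.
Import Order.TTheory GRing.Theory Num.Theory numFieldNormedType.Exports.
Local Open Scope classical_set_scope.
Local Open Scope ring_scope.

(** * Expected payoffs and indifference at equilibrium *)

Section Game.
Context {R : realType} {n : nat}.
Implicit Types (q c : 'I_n -> R) (i : 'I_n).

(** Independence: expanding the product of two-term sums yields one term per profile. *)
Lemma sum_prob_profile_prod q (G : 'I_n -> bool -> R) :
  \sum_(a : profile n) prob_profile q a * \prod_j G j (a j) =
  \prod_j (q j * G j true + (1 - q j) * G j false).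
Proof.
transitivity (\prod_j \sum_(b : bool)
    (if b then q j else 1 - q j) * G j b).
  rewrite bigA_distr_bigA; apply: eq_bigr => a _.
  by rewrite /prob_profile -big_split.
by apply: eq_bigr => j _; rewrite big_bool.
Qed.

(** Transmitting always costs [c i], and being the only transmitter brings [1 + c i]. Both terms are
    products of single-player factors, so their expectations factor. *)
Lemma utilE c i (a : profile n) :
  util c i a = (1 + c i) * \prod_j ((j == i) == a j)%:R - c i * (a i)%:R.
Proof.
rewrite /util (bigD1 i) //= eqxx.
case: (boolP (a i)) => ai; last by rewrite mul0r !mulr0 subr0.
rewrite mul1r mulr1 /ntx (bigD1 i) //= ai add1n eqSS sum_nat_eq0.
case: forallP => [/= a0|/forallP].
  rewrite big1 ?mulr1 ?addrK// => j ji.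
  by move: (implyP (a0 j) ji); rewrite eqb0 (negbTE ji); case: (a j).
rewrite negb_forall => /existsP[j]; rewrite negb_imply eqb0 negbK => /andP[ji aj].
by rewrite (bigD1 j)//= (negbTE ji) aj mul0r mulr0 sub0r.
Qed.

Lemma exp_util_upd c q i r :
  exp_util c (upd q i r) i =
  r * ((1 + c i) * \prod_(j | j != i) (1 - q j) - c i).
Proof.
have updi : upd q i r i = r by rewrite /upd eqxx.
have updj j : j != i -> upd q i r j = q j by rewrite /upd => /negbTE ->.
rewrite /exp_util.
under [LHS]eq_bigr => a _ do rewrite utilE mulrBr mulrCA [_ * (c i * _)]mulrCA.
rewrite big_split /= sumrN -!mulr_sumr (sum_prob_profile_prod _ (fun j b => ((j == i) == b)%:R)).
have -> : \sum_(a : profile n) prob_profile (upd q i r) a * (a i)%:R = r.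
  under eq_bigr => a _.
    have -> : (a i)%:R = \prod_j (if j == i then (a j)%:R else 1) :> R.
      by rewrite (bigD1 i)//= eqxx big1 ?mulr1// => j /negbTE ->.
    over.
  rewrite (sum_prob_profile_prod _ (fun j (b : bool) => if j == i then b%:R else 1)).
  rewrite (bigD1 i)//= eqxx updi mulr1 mulr0 addr0 big1 ?mulr1// => j /negbTE ->.
  by rewrite !mulr1 addrC subrK.
rewrite (bigD1 i)//= eqxx updi mulr1 mulr0 addr0.
under eq_bigr => j ji do rewrite (negbTE ji) updj// mulr0 add0r mulr1.
by rewrite mulrBr mulrCA [r * c i]mulrC.
Qed.

(* At an interior equilibrium the payoff from transmitting, which is affine in
   the own transmission probability, must vanish. *)
Lemma FMNE_indifference c q i : is_FMNE c q ->
  (1 + c i) * \prod_j (1 - q j) = c i * (1 - q i).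
Proof.
move=> [[_ NE] /(_ i)/andP[qi0 qi1]].
set U := (1 + c i) * \prod_(j | j != i) (1 - q j) - c i.
have qiE : exp_util c q i = q i * U.
  rewrite -exp_util_upd; congr (exp_util _ _ _); apply/funext => j.
  by rewrite /upd; case: eqP => [->|].
(* Deviating to 0 and to 1 gives 0 <= q_i U and U <= q_i U, hence U = 0 as 0 < q_i < 1. *)
have := NE i 0; have := NE i 1; rewrite !exp_util_upd qiE -/U !lexx ler01 mul0r mul1r.
move=> /(_ isT) U1 /(_ isT) U0.
have U_eq0 : U = 0.
  apply/eqP; rewrite eq_le; apply/andP; split; last by rewrite -(pmulr_rge0 _ qi0).
  by rewrite -(pmulr_rle0 (x := 1 - q i)) ?subr_gt0// mulrBl mul1r subr_le0.
rewrite (bigD1 i)//= mulrCA -[X in X = _](subrK ((1 - q i) * c i)) -mulrBr -/U.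
by rewrite U_eq0 mulr0 add0r mulrC.
Qed.

End Game.

(** * Truncated l1 norms of polynomials *)

Section L1.
Context {R : realType}.
Implicit Types (P Q : {poly R}) (M : nat).

(** Cutting at [M] keeps the sums finite; bounds uniform in [M] pass to the series [dV] at the
    end. *)
Definition l1 M P : R := \sum_(k < M) `|P`_k|.

Lemma l1_ge0 M P : 0 <= l1 M P.
Proof. exact: sumr_ge0. Qed.

Lemma l1D M P Q : l1 M (P + Q) <= l1 M P + l1 M Q.
Proof.
by rewrite /l1 -big_split; apply: ler_sum => k _; rewrite coefD ler_normD.
Qed.

Lemma l1Z M a P : l1 M (a *: P) = `|a| * l1 M P.
Proof. by rewrite /l1 mulr_sumr; apply: eq_bigr => k _; rewrite coefZ normrM. Qed.

Lemma l1N M P : l1 M (- P) = l1 M P.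
Proof. by rewrite -scaleN1r l1Z normrN1 mul1r. Qed.

Lemma l1_distC M P Q : l1 M (P - Q) = l1 M (Q - P).
Proof. by rewrite -l1N opprB. Qed.

Lemma l1_triangle M Q P T : l1 M (P - T) <= l1 M (P - Q) + l1 M (Q - T).
Proof. by rewrite -[in X in X <= _](subrK Q P) -addrA l1D. Qed.

Lemma l1_eq0 M P : (forall k, (k < M)%N -> P`_k = 0) -> l1 M P = 0.
Proof. by move=> P0; apply: big1 => k _; rewrite P0 ?normr0. Qed.

Lemma l1_Xn M m : l1 M 'X^m <= 1.
Proof.
rewrite /l1; under eq_bigr do rewrite coefXn normr_nat.
have [mM|Mm] := ltnP m M.
  rewrite (bigD1 (Ordinal mM))//= eqxx big1 ?addr0// => k.
  by rewrite -val_eqE /= => /negbTE ->.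
rewrite big1// => k _; rewrite (_ : _ == _ = false)//.
by apply/negbTE; rewrite neq_ltn (leq_trans (ltn_ord k) Mm).
Qed.

(* The sum of the first M coefficients of a product of polynomials with
   nonnegative coefficients is at most the value of the product at 1. *)
Lemma l1M M P Q : l1 M (P * Q) <= l1 M P * l1 M Q.
Proof.
pose abs (T : {poly R}) : {poly R} := \poly_(k < M) `|T`_k|.
have abs1 T : l1 M T = (abs T).[1].
  by rewrite horner_poly; apply: eq_bigr => k _; rewrite expr1n mulr1.
have abs_ge0 T k : 0 <= (abs T)`_k by rewrite coef_poly; case: ifP.
have absM_ge0 k : 0 <= (abs P * abs Q)`_k.
  by rewrite coefM; apply: sumr_ge0 => i _; rewrite mulr_ge0.
rewrite (abs1 P) (abs1 Q) -hornerM /l1.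
rewrite (@horner_coef_wide _ (M + size (abs P * abs Q))) ?leq_addl//.
rewrite big_split_ord /= ler_wpDr//.
  by apply: sumr_ge0 => i _; rewrite expr1n mulr1.
apply: ler_sum => k _; rewrite expr1n mulr1 !coefM.
rewrite (le_trans (ler_norm_sum _ _ _))//; apply: ler_sum => i _.
have iM : (i < M)%N by rewrite (leq_ltn_trans _ (ltn_ord k))// -ltnS.
have kiM : (k - i < M)%N by rewrite (leq_ltn_trans (leq_subr _ _)).
by rewrite !coef_poly iM kiM normrM.
Qed.

Lemma l1_prod_le1 M (I : eqType) (r : seq I) (F : I -> {poly R}) :
  (forall i, i \in r -> l1 M (F i) <= 1) -> l1 M (\prod_(i <- r) F i) <= 1.
Proof.
move=> F1; rewrite big_seq; elim/big_rec: _ => [|i Q ir Q1].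
  by rewrite -(expr0 'X) l1_Xn.
by rewrite (le_trans (l1M _ _ _))// mulr_ile1 ?l1_ge0 ?F1.
Qed.

(** Exchange one factor at a time, through [P' * Q]; the factor kept has norm at most 1. *)
Lemma l1_mul_dist M P P' Q Q' : l1 M P' <= 1 -> l1 M Q <= 1 ->
  l1 M (P * Q - P' * Q') <= l1 M (P - P') + l1 M (Q - Q').
Proof.
move=> P1 Q1; have -> : P * Q - P' * Q' = (P - P') * Q + P' * (Q - Q') by ring.
rewrite (le_trans (l1D _ _ _))// lerD// (le_trans (l1M _ _ _))//.
  by rewrite ler_piMr ?l1_ge0.
by rewrite ler_piMl ?l1_ge0.
Qed.

Lemma l1_prod_dist M (I : eqType) (r : seq I) (F G : I -> {poly R}) :
  (forall i, i \in r -> l1 M (F i) <= 1) ->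
  (forall i, i \in r -> l1 M (G i) <= 1) ->
  l1 M (\prod_(i <- r) F i - \prod_(i <- r) G i) <=
  \sum_(i <- r) l1 M (F i - G i).
Proof.
elim: r => [|i r IH] F1 G1; first by rewrite !big_nil subrr l1_eq0// => k _; rewrite coef0.
have F1' j : j \in r -> l1 M (F j) <= 1 by move=> jr; rewrite F1// inE jr orbT.
have G1' j : j \in r -> l1 M (G j) <= 1 by move=> jr; rewrite G1// inE jr orbT.
rewrite !big_cons (le_trans (l1_mul_dist _ _ _ _ _ _ _))//.
- by rewrite G1// inE eqxx.
- exact: l1_prod_le1.
- by rewrite lerD2l IH.
Qed.

End L1.

(** * Generating polynomials, Bernoulli and Poisson approximation *)

Section GeneratingPolynomials.
Context {R : realType}.
Implicit Types (M : nat) (s t q : R).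

Definition bern_poly q : {poly R} := (1 - q) *: 'X^0 + q *: 'X^1.

(* Truncation makes the Poisson generating function a polynomial; only the
   coefficients below M are ever compared. *)
Definition pois_poly M s : {poly R} :=
  \poly_(k < M) (s ^+ k / k`!%:R * expR (- s)).

(** Expanded over profiles, the product has for each profile its probability times ['X] to the
    number of transmitters. *)
Lemma law_sumE n (q : 'I_n -> R) k :
  law_sum q k = (\prod_i bern_poly (q i))`_k.
Proof.
have -> : \prod_i bern_poly (q i) =
    \sum_(a : profile n) prob_profile q a *: 'X^(ntx a).
  transitivity (\prod_i \sum_(b : bool)
      (if b then q i else 1 - q i) *: 'X^(b : nat) : {poly R}).
    by apply: eq_bigr => i _; rewrite big_bool /= addrC.
  rewrite bigA_distr_bigA; apply: eq_bigr => a _.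
  by rewrite scaler_prod -expr_sum.
rewrite coef_sum /law_sum [LHS]big_mkcond; apply: eq_bigr => a _.
by rewrite coefZ coefXn eq_sym; case: eqP => _; rewrite ?mulr1 ?mulr0.
Qed.

Lemma law_sum_ge0 n (q : 'I_n -> R) k :
  (forall i, 0 <= q i <= 1) -> 0 <= law_sum q k.
Proof.
move=> q01; apply: sumr_ge0 => a _; apply: prodr_ge0 => j _.
by have /andP[q0 q1] := q01 j; case: ifP => _ //; rewrite subr_ge0.
Qed.

Lemma l1_bern_poly M q : 0 <= q <= 1 -> l1 M (bern_poly q) <= 1.
Proof.
move=> /andP[q0 q1]; rewrite (le_trans (l1D _ _ _))// !l1Z.
rewrite !ger0_norm ?subr_ge0// -[leRHS](subrK q).
by rewrite lerD// ler_piMr ?subr_ge0// l1_Xn.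
Qed.

Lemma l1_bern_poly_dist M q q' :
  l1 M (bern_poly q - bern_poly q') <= 2 * `|q - q'|.
Proof.
have -> : bern_poly q - bern_poly q' = (q - q') *: ('X^1 - 'X^0).
  by rewrite /bern_poly -!mul_polyC !rmorphB /= rmorph1; ring.
rewrite l1Z mulrC ler_wpM2r// (le_trans (l1D _ _ _))// l1N.
by rewrite -[leRHS]/(1 + 1) lerD ?l1_Xn.
Qed.

Lemma sum_exp_coeff_le M s : 0 <= s -> \sum_(k < M) s ^+ k / k`!%:R <= expR s.
Proof.
move=> s0; have := is_cvg_series_exp_coeff s; rewrite /expR => cvg_s.
apply: le_trans (nondecreasing_cvgn_le _ cvg_s M).
  by rewrite seriesEord.
by apply: nondecreasing_series => *; exact: exp_coeff_ge0.
Qed.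

Lemma pois_poly_coef_ge0 M s k : 0 <= s -> 0 <= (pois_poly M s)`_k.
Proof.
move=> s0; rewrite coef_poly; case: ifP => // _.
by rewrite mulr_ge0 ?divr_ge0 ?exprn_ge0 ?expR_ge0.
Qed.

Lemma l1_pois_poly M s : 0 <= s -> l1 M (pois_poly M s) <= 1.
Proof.
move=> s0; rewrite /l1.
under eq_bigr => k _ do
  rewrite ger0_norm ?pois_poly_coef_ge0// coef_poly ltn_ord.
rewrite -mulr_suml expRN ler_pdivrMr ?expR_gt0// mul1r.
exact: sum_exp_coeff_le.
Qed.

(** Additivity of Poisson laws, by the binomial theorem; a coefficient below [M] of the product
    involves only coefficients below [M]. *)
Lemma pois_poly_coefM M s t k : (k < M)%N ->
  (pois_poly M s * pois_poly M t)`_k = (pois_poly M (s + t))`_k.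
Proof.
move=> kM; rewrite coefM coef_poly kM addrC exprDn mulr_suml mulr_suml.
apply: eq_bigr => i _; have ik : (i <= k)%N by rewrite -ltnS.
rewrite !coef_poly (leq_ltn_trans ik kM) (leq_ltn_trans (leq_subr _ _) kM).
rewrite opprD expRD.
have fk : 'C(k, i)%:R / k`!%:R = (i`!%:R * (k - i)`!%:R)^-1 :> R.
  have /(congr1 (fun m => m%:R : R)) := bin_fact ik.
  rewrite !natrM => <-; rewrite invfM mulrA divff ?mul1r//.
  by rewrite pnatr_eq0 -lt0n bin_gt0.
by rewrite -[_ *+ 'C(k, i)]mulr_natr -[_ * 'C(k, i)%:R / _]mulrA fk invfM; ring.
Qed.

Lemma pois_poly0_coef M k : (k < M)%N -> (pois_poly M 0)`_k = (1 : {poly R})`_k.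
Proof.
move=> kM; rewrite coef_poly kM oppr0 expR0 mulr1 coef1 expr0n.
by case: k {kM} => [|k] /=; rewrite ?mul0r// fact0 invr1 mulr1.
Qed.

(** Not an equality of polynomials: the product of truncations has further terms from degree [M] on,
    which [l1 M] ignores. *)
Lemma l1_pois_poly_prod M (I : eqType) (r : seq I) (s : I -> R) :
  (forall i, i \in r -> 0 <= s i) ->
  l1 M (\prod_(i <- r) pois_poly M (s i) - pois_poly M (\sum_(i <- r) s i)) <= 0.
Proof.
elim: r => [|i r IH] s0.
  rewrite !big_nil l1_eq0// => k kM.
  by rewrite coefB pois_poly0_coef// subrr.
have s0' j : j \in r -> 0 <= s j by move=> jr; rewrite s0// inE jr orbT.
have si0 : 0 <= s i by rewrite s0// inE eqxx.
rewrite !big_cons.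
rewrite (le_trans (l1_triangle _ (pois_poly M (s i) * pois_poly M (\sum_(j <- r) s j)) _ _))//.
rewrite -[leRHS]addr0 lerD//; last first.
  by rewrite l1_eq0// => k kM; rewrite coefB pois_poly_coefM// subrr.
rewrite -mulrBr (le_trans (l1M _ _ _))//.
by rewrite (le_trans _ (IH s0'))// ler_piMl ?l1_ge0// l1_pois_poly.
Qed.

(** Both laws give 0 the mass e^-s, so the Poisson law differs only by moving mass from 1 to larger
    integers. The distance is at most twice that mass, 1 - e^-s - s e^-s <= s^2. *)
Lemma l1_bern_pois_dist M s : 0 <= s ->
  l1 M (bern_poly (1 - expR (- s)) - pois_poly M s) <= 2 * s ^+ 2.
Proof.
move=> s0; have ge1N := expR_ge1Dx (- s); have ge1 := expR_ge1Dx s.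
have e0 := expR_gt0 (- s).
have eE : expR (- s) * expR s = 1 by rewrite -expRD addNr expR0.
have d0 : 0 <= 1 - expR (- s) - s * expR (- s) by nra.
have tail m : \sum_(k < m) s ^+ k.+2 / k.+2`!%:R * expR (- s) <=
    1 - expR (- s) - s * expR (- s).
  have := sum_exp_coeff_le m.+2 s s0; rewrite 2!big_ord_recl /= !expr1 invr1.
  rewrite expr0 !mulr1 -mulr_suml; under eq_bigr do rewrite /= /bump/= !add1n.
  by set T := \sum_(_ < _) _ => Tle; nra.
have coef_bern k : (bern_poly (1 - expR (- s)))`_k =
    if k == 0%N then expR (- s) else if k == 1%N then 1 - expR (- s) else 0.
  rewrite coefD !coefZ !coefXn subKr.
  by case: k => [|[|k]] /=; rewrite ?mulr0 ?mulr1 ?addr0 ?add0r.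
have le_sq : 2 * (1 - expR (- s) - s * expR (- s)) <= 2 * s ^+ 2 by nra.
case: M => [|[|m]].
- by rewrite /l1 big_ord0; nra.
- rewrite /l1 big_ord1 coefB coef_bern coef_poly /= expr0 fact0 invr1 !mul1r.
  by rewrite subrr normr0; nra.
rewrite /l1 2!big_ord_recl !coefB !coef_bern !coef_poly /= expr0 fact0 invr1.
rewrite !mul1r subrr normr0 add0r !expr1 mulr1 ger0_norm//.
rewrite (le_trans _ le_sq)// mulrDl mul1r lerD2l.
apply: le_trans (tail m); apply: ler_sum => k _.
rewrite coefB coef_bern coef_poly /bump /= !add1n ltnS ltnS ltn_ord sub0r normrN.
by rewrite ger0_norm// mulr_ge0 ?divr_ge0 ?exprn_ge0 ?expR_ge0.
Qed.

(** For s <= t, splitting Po(t) as Po(s) + Po(h) with h = t - s leaves the distance from Po(h) to 0,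
    at most 2 (1 - e^-h) <= 2 h. *)
Lemma l1_pois_poly_dist M s t : 0 <= s -> 0 <= t ->
  l1 M (pois_poly M s - pois_poly M t) <= 2 * `|s - t|.
Proof.
wlog st : s t / s <= t => [wl s0 t0|s0 _].
  have [st|/ltW ts] := leP s t; first exact: wl.
  by rewrite l1_distC distrC wl.
pose h := t - s; have h0 : 0 <= h by rewrite subr_ge0.
have -> : `|s - t| = h by rewrite distrC ger0_norm.
rewrite (le_trans (l1_triangle _ (pois_poly M s * pois_poly M h) _ _))//.
rewrite [X in _ + X]l1_eq0 => [|k kM]; last first.
  by rewrite coefB pois_poly_coefM// [s + h]addrC subrK subrr.
rewrite addr0 -[in X in l1 M (X - _)](mulr1 (pois_poly M s)) -mulrBr.
rewrite (le_trans (l1M _ _ _))// (@le_trans _ _ (l1 M (1 - pois_poly M h)))//.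
  by rewrite ler_piMl ?l1_ge0 ?l1_pois_poly.
have e1 : expR (- h) <= 1 by rewrite -expR0 ler_expR oppr_le0.
have ge1N := expR_ge1Dx (- h).
case: M => [|m]; first by rewrite /l1 big_ord0 mulr_ge0.
rewrite /l1 big_ord_recl coefB coef1 coef_poly /= expr0 fact0 invr1 !mul1r.
rewrite ger0_norm ?subr_ge0//.
rewrite (eq_bigr (fun k : 'I_m => h ^+ k.+1 / k.+1`!%:R * expR (- h))); last first.
  move=> k _; rewrite coefB coef1 coef_poly /bump /= add1n ltnS ltn_ord sub0r normrN.
  by rewrite ger0_norm// mulr_ge0 ?divr_ge0 ?exprn_ge0 ?expR_ge0.
rewrite -mulr_suml; have := sum_exp_coeff_le m.+1 h h0.
rewrite big_ord_recl /= expr0 fact0 invr1 mul1r.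
under eq_bigr do rewrite /= /bump/= add1n.
have eE : expR (- h) * expR h = 1 by rewrite -expRD addNr expR0.
have e0 := expR_gt0 (- h).
by set T := \sum_(_ < _) _ => Tle; nra.
Qed.

(* Replace Bern(q_i) by Bern(q'_i) for i < K (coupling), by Po(s_i) for
   i >= K (Le Cam), and finally the sum of the s_i by lam. *)
Lemma l1_sum_bern_pois_dist M K n (q q' s : nat -> R) lam : (K <= n)%N ->
  0 <= lam -> (forall i, (i < n)%N -> 0 <= q i <= 1) ->
  (forall i, (i < K)%N -> 0 <= q' i <= 1) ->
  (forall i, (K <= i < n)%N -> 0 <= s i) ->
  (forall i, (K <= i < n)%N -> q i = 1 - expR (- s i)) ->
  l1 M (\prod_(i < n) bern_poly (q i) -
        pois_poly M lam * \prod_(i < K) bern_poly (q' i)) <=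
  2 * (\sum_(i < K) `|q i - q' i| + \sum_(K <= i < n) s i ^+ 2 +
       `|\sum_(K <= i < n) s i - lam|).
Proof.
move=> Kn lam0 q01 q'01 s0 qE.
rewrite -(big_mkord xpredT (fun i => bern_poly (q i))) [\prod_(0 <= i < n) _](big_cat_nat _ Kn)//=.
rewrite big_mkord [pois_poly _ _ * _]mulrC.
have in_tail i : i \in index_iota K n -> (K <= i < n)%N by rewrite mem_index_iota.
have tailP : l1 M (\prod_(K <= i < n) bern_poly (q i)) <= 1.
  apply: l1_prod_le1 => i /in_tail/andP[_ ?]; exact/l1_bern_poly/q01.
rewrite (le_trans (l1_mul_dist _ _ _ _ _ _ _))//.
  by apply: l1_prod_le1 => i _; exact/l1_bern_poly/q'01.
rewrite -addrA mulrDr lerD//.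
  rewrite (le_trans (l1_prod_dist _ _ _ _ _ _ _))//.
  - by move=> i _; exact/l1_bern_poly/q01/(leq_trans (ltn_ord i)).
  - by move=> i _; exact/l1_bern_poly/q'01.
  - by rewrite mulr_sumr; apply: ler_sum => i _; exact: l1_bern_poly_dist.
rewrite (le_trans (l1_triangle _ (\prod_(K <= i < n) pois_poly M (s i)) _ _))//.
rewrite mulrDr lerD//.
  rewrite (le_trans (l1_prod_dist _ _ _ _ _ _ _))//.
  - by move=> i /in_tail/andP[_ ?]; exact/l1_bern_poly/q01.
  - by move=> i /in_tail ?; exact/l1_pois_poly/s0.
  - rewrite mulr_sumr big_seq [leRHS]big_seq; apply: ler_sum => i /in_tail iKn.
    by rewrite qE// l1_bern_pois_dist// s0.
rewrite (le_trans (l1_triangle _ (pois_poly M (\sum_(K <= i < n) s i)) _ _))//.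
rewrite -[leRHS]add0r lerD//.
  by apply: l1_pois_poly_prod => i /in_tail; exact: s0.
apply: l1_pois_poly_dist => //.
by rewrite big_seq; apply: sumr_ge0 => i /in_tail; exact: s0.
Qed.

(** Bridge from laws to polynomials; [poisson_pmf] tests the sign of its rate, whence [0 < lam]. *)
Lemma sum_dist_law_sum_pois M K n (q : 'I_n -> R) (q' : 'I_K -> R) lam : 0 < lam ->
  \sum_(k < M) `|law_sum q k - pmf_conv (poisson_pmf lam) (law_sum q') k| =
  l1 M (\prod_i bern_poly (q i) - pois_poly M lam * \prod_i bern_poly (q' i)).
Proof.
move=> lam0; apply: eq_bigr => k _; rewrite coefB law_sumE coefM.
congr (`|_ - _|); apply: eq_bigr => i _.
have iM : (i < M)%N by rewrite (leq_ltn_trans _ (ltn_ord k))// -ltnS.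
by rewrite law_sumE coef_poly iM /poisson_pmf lam0.
Qed.

End GeneratingPolynomials.

(** * Asymptotics of the equilibrium in logarithms *)

Section LogCosts.
Context {R : realType} (al : nat -> R).

(* al i = ln a_(i+1) and L n = ln P(S_(n+2) = 0) in the game with n + 2
   players. *)
Definition idle_log n : R := (\sum_(i < n.+2) al i) / n.+1%:R.

Local Notation L := idle_log.

Hypothesis al_lt0 : forall i, al i < 0.
Hypothesis L_lt_al : forall n i, (i < n.+2)%N -> L n < al i.

Definition lim_idle_log : R := limn L.

Local Notation Linf := lim_idle_log.

Lemma idle_logE n : n.+1%:R * L n = \sum_(i < n.+2) al i.
Proof. by rewrite mulrC divfK// pnatr_eq0. Qed.

(* L n.+1 is a weighted mean of L n and al n.+2, which exceeds L n.+1. *)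
Lemma idle_log_ltS n : L n < L n.+1.
Proof.
have e1 := idle_logE n; have e2 := idle_logE n.+1.
have := @L_lt_al n.+1 n.+2 (ltnSn _).
rewrite big_ord_recr /= -e1 in e2.
have n0 : 0 < n.+1%:R :> R by rewrite ltr0n.
rewrite [n.+2%:R]mulrS in e2.
by nra.
Qed.

Lemma idle_log_nondecreasing : nondecreasing_seq L.
Proof. by apply/nondecreasing_seqP => n; exact/ltW/idle_log_ltS. Qed.

(** By monotonicity, pass to index [n + i], where player [i] takes part. *)
Lemma idle_log_lt_al n i : L n < al i.
Proof.
rewrite (le_lt_trans (idle_log_nondecreasing _ _ (leq_addr i n)))// L_lt_al//.
by rewrite (leq_ltn_trans (leq_addl n i)).
Qed.

Lemma cvg_idle_log : L n @[n --> \oo] --> Linf.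
Proof.
apply: nondecreasing_is_cvgn; first exact: idle_log_nondecreasing.
by exists (al 0%N) => _ [n _ <-]; exact/ltW/idle_log_lt_al.
Qed.

(** Strictness makes [gap] positive, hence also the Poisson mean built from it. *)
Lemma idle_log_lt_lim n : L n < Linf.
Proof.
rewrite (lt_le_trans (idle_log_ltS n))//.
by apply: nondecreasing_cvgn_le; [exact: idle_log_nondecreasing|exact: cvg_idle_log].
Qed.

Lemma lim_idle_log_le_al i : Linf <= al i.
Proof.
apply: limr_le; first exact: cvg_idle_log.
by near=> n; exact/ltW/idle_log_lt_al.
Unshelve. all: by end_near. Qed.

Lemma lim_idle_log_lt0 : Linf < 0.
Proof. exact: le_lt_trans (lim_idle_log_le_al 0) (al_lt0 0). Qed.

(** Index [n] stands for [n + 2] players, so n - 1 of the informal proof becomes [n.+1]. *)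
Definition gap n : R := Linf - L n.

Definition limit_rate i : R := al i - Linf.

Local Notation T := gap.
Local Notation r := limit_rate.

Lemma gap_gt0 n : 0 < T n.
Proof. by rewrite subr_gt0 idle_log_lt_lim. Qed.

Lemma cvg_gap : T n @[n --> \oo] --> (0 : R).
Proof. by rewrite -(subrr Linf); apply: cvgB; [exact: cvg_cst|exact: cvg_idle_log]. Qed.

Lemma limit_rate_ge0 i : 0 <= r i.
Proof. by rewrite subr_ge0 lim_idle_log_le_al. Qed.

Lemma rateE i n : al i - L n = r i + T n.
Proof. by rewrite /limit_rate /gap addrA subrK. Qed.

(** Here [al i - L n] is - ln (1 - p_i), and the product of the 1 - p_i is the probability of
    silence. *)
Lemma sum_rate n : \sum_(i < n.+2) (al i - L n) = - L n.
Proof.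
rewrite big_split /= sumrN -idle_logE sumr_const card_ord -[L n *+ _]mulr_natl.
by rewrite [n.+2%:R]mulrS; ring.
Qed.

Lemma sum_limit_rate n : \sum_(i < n.+2) r i = - Linf - n.+1%:R * T n.
Proof.
rewrite big_split /= sumrN -idle_logE sumr_const card_ord -[Linf *+ _]mulr_natl.
by rewrite [n.+2%:R]mulrS /gap; ring.
Qed.

Lemma cvg_series_limit_rate : cvgn (series r).
Proof.
apply: nondecreasing_is_cvgn.
  by apply: nondecreasing_series => *; exact: limit_rate_ge0.
exists (- Linf) => _ [n _ <-].
(* [sum_limit_rate] only covers lengths of the form [n.+2]. *)
apply: (@le_trans _ _ (series r n.+2)).
  by apply: nondecreasing_series; [move=> *; exact: limit_rate_ge0|exact/leqW/leqW].
rewrite seriesEord /= sum_limit_rate lerBlDr lerDl.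
by rewrite mulr_ge0// ltW ?gap_gt0.
Qed.

Lemma one_sub_expRN_le (x : R) : 1 - expR (- x) <= x.
Proof. by have := expR_ge1Dx (- x); lra. Qed.

Lemma one_sub_expRN_ge (x : R) : x * expR (- x) <= 1 - expR (- x).
Proof.
have eE : expR (- x) * expR x = 1 by rewrite -expRD addNr expR0.
by have := expR_gt0 (- x); have := expR_ge1Dx x; nra.
Qed.

(** Bound one factor of each square by [d]; the rates add up to [- L n], at most [- L 0]. *)
Lemma sum_rate_tail_sq_le (k n : nat) d : (k <= n)%N ->
  (forall i, (k.+2 <= i)%N -> r i + T n <= d) ->
  \sum_(k.+2 <= i < n.+2) (al i - L n) ^+ 2 <= d * - L 0%N.
Proof.
move=> kn rd; have kn2 : (k.+2 <= n.+2)%N by [].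
have s_ge0 i : 0 <= al i - L n by rewrite subr_ge0 ltW ?idle_log_lt_al.
have d0 : 0 <= d by apply: le_trans (rd k.+2 (leqnn _)); rewrite -rateE.
apply: (@le_trans _ _ (d * \sum_(k.+2 <= i < n.+2) (al i - L n))).
  rewrite mulr_sumr big_nat [leRHS]big_nat; apply: ler_sum => i /andP[ki _].
  by rewrite expr2 ler_wpM2r// rateE rd.
rewrite ler_wpM2l//; apply: (@le_trans _ _ (\sum_(i < n.+2) (al i - L n))).
  rewrite -(big_mkord xpredT (fun i => al i - L n)).
  by rewrite [leRHS](big_cat_nat _ kn2)//= lerDr sumr_ge0.
by rewrite sum_rate lerN2 idle_log_nondecreasing.
Qed.

(** This dictates the Poisson mean [k.+1%:R * T k]: for fixed [k] the tail rates add up to it in the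
    limit. *)
Lemma sum_rate_tail (k n : nat) : (k <= n)%N ->
  \sum_(k.+2 <= i < n.+2) (al i - L n) - k.+1%:R * T k = - (k.+1%:R * T n).
Proof.
move=> kn; have kn2 : (k.+2 <= n.+2)%N by [].
have := sum_rate n; rewrite -(big_mkord xpredT (fun i => al i - L n)).
rewrite (big_cat_nat _ kn2)//= big_mkord big_split /= sumrN -idle_logE.
rewrite sumr_const card_ord -[L n *+ _]mulr_natl [k.+2%:R]mulrS /gap.
by move=> e; lra.
Qed.

Lemma dist_expRN_limit_rate i n :
  `|(1 - expR (- (al i - L n))) - (1 - expR (- r i))| <= T n.
Proof.
rewrite rateE opprD expRD.
have -> : 1 - expR (- r i) * expR (- T n) - (1 - expR (- r i)) =
  expR (- r i) * (1 - expR (- T n)) by ring.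
have T0 := ltW (gap_gt0 n).
have r1 : expR (- r i) <= 1 by rewrite -expR0 ler_expR oppr_le0 limit_rate_ge0.
have T1 : expR (- T n) <= 1 by rewrite -expR0 ler_expR oppr_le0.
rewrite normrM !ger0_norm ?subr_ge0 ?expR_ge0//.
rewrite (le_trans _ (one_sub_expRN_le _))// ler_piMl ?subr_ge0//.
Qed.

Lemma bern_pois_approx (eps : R) : 0 < eps ->
  exists k N, forall n, (N <= n)%N -> forall M,
   l1 M (\prod_(i < n.+2) bern_poly (1 - expR (- (al i - L n))) -
     pois_poly M (k.+1%:R * T k) *
       \prod_(i < k.+2) bern_poly (1 - expR (- r i))) <= eps.
Proof.
move=> eps0; have L00 : 0 < - L 0%N.
  by rewrite oppr_gt0 (lt_trans (idle_log_lt_lim 0))// lim_idle_log_lt0.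
(* With this [d] the squares cost at most eps / 4. The index [k] makes the later [r i] at most d /
   2. *)
pose d := eps / 4 / - L 0%N; have d0 : 0 < d by rewrite !divr_gt0.
have d2 : 0 < d / 2 by rewrite divr_gt0.
have [k _ rk] := cvgr0_norm_le _ (cvg_series_cvg_0 cvg_series_limit_rate) _ d2.
(* The first bound completes [r i + T n <= d]; the second keeps head error and mean error together
   below eps / 4. The factor 2 then gives eps. *)
have e2 : 0 < Num.min (d / 2) (eps / 4 / (k.+2%:R + k.+1%:R)).
  by rewrite lt_min d2 !divr_gt0// -natrD ltr0n.
have [N _ TN] := cvgr0_norm_le _ cvg_gap _ e2.
exists k, (maxn k N) => n; rewrite geq_max => /andP[kn Nn] M.
have kn2 : (k.+2 <= n.+2)%N by [].
have {TN} := TN n Nn; rewrite /= ger0_norm ?(ltW (gap_gt0 n))// le_min.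
move=> /andP[Td Te].
have p01 (x : R) : 0 <= x -> 0 <= 1 - expR (- x) <= 1.
  by move=> x0; rewrite subr_ge0 gerBl expR_ge0 -expR0 ler_expR oppr_le0 x0.
have s_ge0 i : 0 <= al i - L n by rewrite subr_ge0 ltW ?idle_log_lt_al.
apply: le_trans (@l1_sum_bern_pois_dist _ M k.+2 n.+2
  (fun i => 1 - expR (- (al i - L n))) (fun i => 1 - expR (- r i))
  (fun i => al i - L n) _ kn2 _ _ _ _ _) _ => //.
- by rewrite mulr_ge0// ltW// gap_gt0.
- by move=> i _; exact: p01.
- by move=> i _; exact/p01/limit_rate_ge0.
rewrite sum_rate_tail// normrN ger0_norm ?mulr_ge0 ?(ltW (gap_gt0 n))//.
have sq : \sum_(k.+2 <= i < n.+2) (al i - L n) ^+ 2 <= d * - L 0%N.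
  apply: sum_rate_tail_sq_le => // i ki.
  have := rk i (leq_trans (leqnSn _) (ltnW ki)); rewrite /= ger0_norm ?limit_rate_ge0//.
  by move=> rd; rewrite [d]splitr lerD.
rewrite divfK ?gt_eqF// in sq.
have head : \sum_(i < k.+2)
   `|1 - expR (- (al i - L n)) - (1 - expR (- r i))| <= k.+2%:R * T n.
  rewrite mulr_natl -[in leRHS](card_ord k.+2) -sumr_const.
  by apply: ler_sum => i _; exact: dist_expRN_limit_rate.
have := Te; rewrite ler_pdivlMr -?natrD ?ltr0n// natrD => Te'.
by lra.
Qed.

Lemma cvg_sum_transmission : exists l : R, 0 < l /\
  \sum_(i < n.+2) (1 - expR (- (al i - L n))) @[n --> \oo] --> l.
Proof.
pose B := series (fun i => 1 - expR (- r i)).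
have B_cvg : cvgn B.
  apply: series_le_cvg cvg_series_limit_rate.
  - by move=> i; rewrite subr_ge0 -expR0 ler_expR oppr_le0 limit_rate_ge0.
  - exact: limit_rate_ge0.
  - by move=> i; exact: one_sub_expRN_le.
have cvge : expR (- T n) @[n --> \oo] --> (1 : R).
  rewrite -expR0; apply: continuous_cvg; first exact: continuous_expR.
  by rewrite -oppr0; exact: cvgN cvg_gap.
pose tau := - Linf - limn (series r).
have cvgnT : n.+2%:R * T n @[n --> \oo] --> tau.
  rewrite [X in X @ _](_ : _ = fun n => - Linf - series r n.+2 + T n); last first.
    by apply/funext => n; rewrite seriesEord /= sum_limit_rate [n.+2%:R]mulrS; ring.
  rewrite -[tau]addr0; apply: cvgD cvg_gap; apply: cvgB; first exact: cvg_cst.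
  by have := cvg_series_limit_rate; rewrite -(cvg_shiftn 2); under eq_fun do rewrite addn2.
(* Squeeze using x e^-x <= 1 - e^-x <= x. *)
have cvgp : n.+2%:R * (1 - expR (- T n)) @[n --> \oo] --> tau.
  apply: (squeeze_cvgr (f := fun n => n.+2%:R * T n * expR (- T n))
                       (h := fun n => n.+2%:R * T n)) => //.
  - near=> n; rewrite -mulrA !ler_wpM2l// ?one_sub_expRN_ge//.
    exact: one_sub_expRN_le.
  - by rewrite -[tau]mulr1; exact: cvgM.
have sumE n : \sum_(i < n.+2) (1 - expR (- (al i - L n))) =
    expR (- T n) * B n.+2 + n.+2%:R * (1 - expR (- T n)).
  have -> : n.+2%:R * (1 - expR (- T n)) = \sum_(i < n.+2) (1 - expR (- T n)).
    by rewrite sumr_const card_ord mulr_natl.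
  rewrite /B seriesEord /= mulr_sumr -big_split /=; apply: eq_bigr => i _.
  by rewrite rateE opprD expRD; ring.
have cvg_sum : \sum_(i < n.+2) (1 - expR (- (al i - L n))) @[n --> \oo] -->
    1 * limn B + tau.
  under eq_fun do rewrite sumE.
  apply: cvgD cvgp; apply: cvgM => //.
  by have := B_cvg; rewrite -(cvg_shiftn 2); under eq_fun do rewrite addn2.
exists (1 * limn B + tau); split => //.
(* Positivity of the limit: each rate x is at most [- L 0], so 1 - e^-x >= x e^(L 0), and the rates
   add up to [- L n], which exceeds [- Linf]. *)
apply: (@lt_le_trans _ _ (- Linf * expR (L 0%N))).
  by rewrite mulr_gt0 ?expR_gt0// oppr_gt0 lim_idle_log_lt0.
rewrite -(cvg_lim _ cvg_sum)//; apply: limr_ge; first by apply/cvg_ex; eexists; exact: cvg_sum.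
near=> n.
apply: (@le_trans _ _ (\sum_(i < n.+2) (al i - L n) * expR (L 0%N))).
  rewrite -mulr_suml sum_rate ler_wpM2r ?expR_ge0// lerN2 ltW//.
  exact: idle_log_lt_lim.
apply: ler_sum => i _; apply: le_trans (one_sub_expRN_ge _).
rewrite ler_wpM2l//; first by rewrite subr_ge0 ltW// idle_log_lt_al.
rewrite ler_expR opprB.
have := idle_log_nondecreasing _ _ (leq0n n); have := al_lt0 i; lra.
Unshelve. all: by end_near. Qed.

End LogCosts.

(** * Distribution functions and their uniform limits *)

Section CumulativeDistribution.
Context {R : realType}.

Lemma ntx_le {n} (a : profile n) : (ntx a <= n)%N.
Proof.
rewrite -[leqRHS]card_ord -sum1_card; apply: leq_sum => j _.
exact: leq_b1.
Qed.

Lemma cdf_sumE M n (q : 'I_n -> R) x : (n < M)%N ->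
  cdf_sum q x = \sum_(k < M | k%:R <= x) law_sum q k.
Proof.
case: M => // M nM; rewrite /cdf_sum.
(* Counts are at most [n], so [inord] does not alter them. *)
have ntxK (a : profile n) : (inord (ntx a) : 'I_M.+1) = ntx a :> nat.
  by apply: inordK; exact: leq_ltn_trans (ntx_le a) nM.
rewrite (partition_big (fun a => inord (ntx a) : 'I_M.+1)
  (fun k : 'I_M.+1 => k%:R <= x)) => [/=|a]; last by rewrite ntxK.
apply: eq_bigr => k kx; apply: eq_bigl => a.
rewrite -val_eqE /= ntxK; case: eqP => [->|]; last by rewrite andbF.
by rewrite kx.
Qed.

Lemma cdf_sum_dist M m n (q : 'I_m -> R) (q' : 'I_n -> R) x :
  (m < M)%N -> (n < M)%N ->
  `|cdf_sum q x - cdf_sum q' x| <= \sum_(k < M) `|law_sum q k - law_sum q' k|.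
Proof.
move=> mM nM; rewrite (cdf_sumE _ _ _ _ mM) (cdf_sumE _ _ _ _ nM) -sumrB.
rewrite (le_trans (ler_norm_sum _ _ _))// [leLHS]big_mkcond.
by apply: ler_sum => k _; case: ifP.
Qed.

Lemma cdf_sum_homo n (q : 'I_n -> R) : (forall i, 0 <= q i <= 1) ->
  {homo cdf_sum q : x y / x <= y}.
Proof.
move=> q01 x y xy; rewrite !(cdf_sumE _ _ _ _ (ltnSn n)).
rewrite [leLHS]big_mkcond [leRHS]big_mkcond; apply: ler_sum => k _.
case: ifP => [kx|_]; first by rewrite (le_trans kx xy).
by case: ifP => // _; exact: law_sum_ge0.
Qed.

Lemma cdf_sum_lt0 n (q : 'I_n -> R) x : x < 0 -> cdf_sum q x = 0.
Proof.
move=> x0; apply: big_pred0 => a; apply/negbTE.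
by rewrite -ltNge (lt_le_trans x0).
Qed.

Lemma cdf_sum_ge_size n (q : 'I_n -> R) x : n%:R <= x -> cdf_sum q x = 1.
Proof.
move=> nx; rewrite /cdf_sum (eq_bigl xpredT) => [|a]; last first.
  by rewrite (le_trans _ nx)// ler_nat ntx_le.
transitivity (\sum_(a : profile n) prob_profile q a * \prod_(j < n) 1).
  by apply: eq_bigr => a _; rewrite big1 ?mulr1.
rewrite (sum_prob_profile_prod _ (fun _ _ => 1)) big1// => j _.
by rewrite !mulr1 addrC subrK.
Qed.

(** Counts are integers, so none lies strictly between x and floor x + 1. This yields right
    continuity of the limit. *)
Lemma cdf_sum_floor n (q : 'I_n -> R) x y :
  x <= y < (Num.floor x + 1)%:~R -> cdf_sum q y = cdf_sum q x.
Proof.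
move=> /andP[xy yx]; apply: eq_bigl => a; apply/idP/idP => [ay|]; last first.
  by move/le_trans; apply.
rewrite (le_trans _ (floor_le x))//.
have : (ntx a)%:R < (Num.floor x + 1)%:~R :> R := le_lt_trans ay yx.
by rewrite !pmulrn ltr_int ltzD1 ler_int.
Qed.

(** Uniformity prevents mass from escaping to infinity: the limit stays within eps of a distribution
    function equal to 1 from [N] on. *)
Lemma cvg_in_distribution_uniform_cauchy (q : forall n, 'I_n -> R) N0 :
  (forall n, (N0 <= n)%N -> forall i, 0 <= q n i <= 1) ->
  (forall eps : R, 0 < eps -> exists N, forall m n, (N <= m)%N -> (N <= n)%N ->
    forall x, `|cdf_sum (q m) x - cdf_sum (q n) x| <= eps) ->
  cvg_in_distribution (fun n => cdf_sum (q n)).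
Proof.
move=> q01 cauchy_q.
have cvg_q x : cvgn (fun n => cdf_sum (q n) x).
  apply/cauchy_cvgP/cauchy_exP => eps eps0.
  have [N qN] := cauchy_q _ (divr_gt0 eps0 (ltr0n R 2)).
  exists (cdf_sum (q N) x), N => // n /= Nn; rewrite /ball /= (le_lt_trans (qN _ _ _ Nn x))//.
  by rewrite ltr_pdivrMr// ltr_pMr// ltr1n.
pose F x := limn (fun n => cdf_sum (q n) x).
have unif_q (eps : R) : 0 < eps ->
    exists N, forall x, `|cdf_sum (q N) x - F x| <= eps.
  move=> /cauchy_q[N qN]; exists N => x.
  have cvg_dist : `|cdf_sum (q N) x - cdf_sum (q n) x| @[n --> \oo] -->
      `|cdf_sum (q N) x - F x|.
    by apply: cvg_norm; apply: cvgB; [exact: cvg_cst|exact: cvg_q].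
  rewrite -(cvg_lim _ cvg_dist)//; apply: limr_le.
    by apply/cvg_ex; eexists; exact: cvg_dist.
  by exists N => // n /= Nn; exact: qN.
exists F; split; last by move=> x _; exact: cvg_q.
split=> [x y xy|].
  apply: ler_lim => //.
  by exists N0 => // n /= Nn; apply: cdf_sum_homo => //; exact: q01.
split=> [x|].
  apply: cvg_near_cst.
  have : x < (Num.floor x + 1)%:~R by exact: floorD1_gt.
  move=> /nbhs_right_lt; apply: filterS2 (nbhs_right_ge (R:=R) x) => y xy yx.
  by rewrite /F; under eq_fun do rewrite (cdf_sum_floor _ _ x) ?xy//.
split.
  apply: cvg_near_cst.
  exists 0; split => // x x0; rewrite /F.
  under eq_fun do rewrite cdf_sum_lt0//.
  exact: lim_cst.
apply/cvgrPdist_le => eps eps0; have [N qN] := unif_q _ eps0.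
exists N%:R; split => // x /ltW Nx; rewrite -(cdf_sum_ge_size _ (q N) x Nx).
exact: qN.
Qed.

End CumulativeDistribution.

(** * From the equilibrium to the theorem *)

Lemma FMNE_transmission {R : realType} (c p : nat -> R) n :
  (forall i, 0 < c i) ->
  is_FMNE (fun i : 'I_n.+2 => c i) (fun i : 'I_n.+2 => p i) ->
  forall i, (i < n.+2)%N ->
  idle_log (fun j => ln (c j / (1 + c j))) n < ln (c i / (1 + c i)) /\
  p i = 1 - expR (- (ln (c i / (1 + c i)) -
                     idle_log (fun j => ln (c j / (1 + c j))) n)).
Proof.
move=> c0 NE; set al := fun j => ln (c j / (1 + c j)).
have p01 (j : 'I_n.+2) : 0 < p j < 1 by case: NE => _ /(_ j).
have q0 (j : 'I_n.+2) : 0 < 1 - p j by rewrite subr_gt0; case/andP: (p01 j).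
pose lA := \sum_(j < n.+2) ln (1 - p j).
have AE : \prod_(j < n.+2) (1 - p j) = expR lA.
  by rewrite expR_sum; apply: eq_bigr => j _; rewrite lnK ?posrE.
have qE (j : 'I_n.+2) : ln (1 - p j) = lA - al j.
  have := FMNE_indifference _ _ j NE; rewrite AE => e.
  have c1 : 0 < 1 + c j by rewrite addr_gt0.
  have -> : 1 - p j = expR lA / (c j / (1 + c j)).
    by rewrite invf_div mulrA [expR lA * _]mulrC e mulrAC divff ?mul1r ?gt_eqF.
  by rewrite ln_div ?posrE ?expR_gt0 ?divr_gt0// expRK.
(* Summing [qE] over the n + 2 players gives (n + 1) lA = sum of the [al j]. *)
have -> : idle_log al n = lA.
  have : lA = \sum_(j < n.+2) (lA - al j) by apply: eq_bigr => j _; exact: qE.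
  rewrite big_split /= sumrN -(idle_logE al) sumr_const card_ord -[lA *+ _]mulr_natl.
  rewrite [n.+2%:R]mulrS mulrDl mul1r => /eqP; rewrite -addrA addrC -subr_eq subrr.
  rewrite eq_sym subr_eq0 => /eqP /mulfI; rewrite pnatr_eq0 => /(_ isT).
  by move=> ->.
move=> i ni; have /= qi := qE (Ordinal ni); have /= p0 := p01 (Ordinal ni).
have /= q0i := q0 (Ordinal ni); split.
  rewrite -/(al i) -subr_lt0 -qi -ln1 ltr_ln ?posrE//.
  by rewrite gtrBl; case/andP: p0.
by rewrite -/(al i) opprB -qi lnK ?posrE// subKr.
Qed.

Lemma dV_le {R : realType} (f g : nat -> R) (x : R) :
  (forall M, \sum_(k < M) `|f k - g k| <= x) -> (dV f g <= x%:E)%E.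
Proof.
move=> fgx; apply: lime_le.
  by apply: is_cvg_nneseries => k _ _; rewrite lee_fin.
by near=> M; rewrite /= sumEFin lee_fin big_mkord.
Unshelve. all: by end_near. Qed.

Lemma limn_esup_le_near {R : realType} (u : nat -> \bar R) (x : \bar R) N :
  (forall n, (N <= n)%N -> (u n <= x)%E) -> (limn_esup u <= x)%E.
Proof.
move=> ux; rewrite limn_esup_lim; apply: lime_le; first exact: is_cvg_esups.
exists N => // n /= Nn; apply: ge_ereal_sup => _ [m /= nm <-].
by apply: ux; exact: leq_trans nm.
Qed.

(* Players are 0-indexed: player i (0 <= i < n) here is transmitter i+1 of
   the paper; c i is c_{i+1} and p i n is p_{i+1,n}. *)
Theorem theorem2 (R : realType) (c : nat -> R) (p : nat -> nat -> R) :
  (forall i, 0 < c i) ->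
  (forall n, (2 <= n)%N ->
     is_FMNE (fun i : 'I_n => c i) (fun i : 'I_n => p i n)) ->
  ((cvg_in_distribution (fun n => cdf_sum (fun i : 'I_n => p i n)))
     <-> (exists l : R, 0 < l /\ \sum_(i < n) p i n @[n --> \oo] --> l))
  /\
  (forall eps : R, 0 < eps ->
     exists (lam : R) (K : nat) (pk : 'I_K -> R),
       0 < lam /\ (forall k, 0 <= pk k <= 1) /\
       (limn_esup (fun n => dV (law_sum (fun i : 'I_n => p i n))
                               (pmf_conv (poisson_pmf lam) (law_sum pk)))
        <= eps%:E)%E).
Proof.
move=> c0 NE; pose al j := ln (c j / (1 + c j)).
have al_lt0 i : al i < 0.
  rewrite ln_lt0// divr_gt0 ?addr_gt0//= ltr_pdivrMr ?addr_gt0//.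
  by rewrite mul1r ltrDr.
have trans n i : (i < n.+2)%N ->
    idle_log al n < al i /\ p i n.+2 = 1 - expR (- (al i - idle_log al n)).
  exact: (FMNE_transmission _ (p ^~ n.+2) _ c0 (NE n.+2 _)).
have L_lt_al n i (ni : (i < n.+2)%N) : idle_log al n < al i := (trans n i ni).1.
have approx (eps : R) : 0 < eps -> exists (lam : R) (K : nat) (pk : 'I_K -> R),
    0 < lam /\ (forall k, 0 <= pk k <= 1) /\
    exists N, forall n, (N <= n)%N -> forall M,
      \sum_(k < M) `|law_sum (fun i : 'I_n => p i n) k -
                     pmf_conv (poisson_pmf lam) (law_sum pk) k| <= eps.
  move=> eps0; have [k [N kN]] := bern_pois_approx al al_lt0 L_lt_al eps eps0.
  have lam0 : 0 < k.+1%:R * gap al k by rewrite mulr_gt0 ?ltr0n// gap_gt0.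
  exists (k.+1%:R * gap al k), k.+2, (fun i => 1 - expR (- limit_rate al i)).
  split=> //; split=> [i|].
    rewrite subr_ge0 gerBl expR_ge0 andbT -expR0 ler_expR oppr_le0.
    exact: limit_rate_ge0.
  (* [bern_pois_approx] counts games from two players on. *)
  exists N.+2; case=> [|[|n]]// Nn M; rewrite sum_dist_law_sum_pois//.
  under eq_bigr => i _ do rewrite (trans n i (ltn_ord i)).2.
  exact: kN.
split; last first.
  move=> eps /approx[lam [K [pk [lam0 [pk01 [N le_eps]]]]]].
  exists lam, K, pk; split=> //; split=> //.
  by apply: (limn_esup_le_near _ _ N) => n Nn; apply: dV_le; exact: le_eps.
split=> _; last first.
  apply: (cvg_in_distribution_uniform_cauchy _ 2) => [n n2 i|eps eps0].
    by have [_ /(_ i)/andP[p0 p1]] := NE n n2; rewrite !ltW.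
  (* One law within eps / 2 of both S_m and S_n serves as the intermediate point. *)
  have /approx[lam [K [pk [_ [_ [N le_eps]]]]]] := divr_gt0 eps0 (ltr0n R 2).
  exists N => m n Nm Nn x; pose M := (maxn m n).+1.
  rewrite (le_trans (cdf_sum_dist M _ _ _ _ _ _ _)) ?ltnS ?leq_maxl ?leq_maxr//.
  rewrite [leRHS]splitr (le_trans _ (lerD (le_eps m Nm M) (le_eps n Nn M)))//.
  rewrite -big_split; apply: ler_sum => k _ /=.
  set g := pmf_conv _ _ _.
  by rewrite [X in _ <= _ + X]distrC (le_trans _ (ler_normD _ _))// addrA subrK.
have [l [l0 cvgl]] := cvg_sum_transmission al al_lt0 L_lt_al.
exists l; split => //; rewrite -(cvg_shiftn 2).
apply: cvg_trans cvgl; apply: near_eq_cvg; apply: nearW => n /=; rewrite addn2.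
by apply: eq_bigr => i _; rewrite (trans n i (ltn_ord i)).2.
Qed.
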